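(* Let $v\equiv 3\pmod 4$ with $v<300$, and let $\alpha,\beta$ be nonzero elements of $\mathbb{Z}_v$. Then there exists an APS$(v,\alpha,\beta)$ if and only if $$2\alpha^2-\beta^2\equiv\begin{cases}\frac{v}{3}\pmod v, & \text{if } v\equiv 3\pmod{12},\\ 0\pmod v, & \text{if } v\equiv 7,11\pmod{12}.\end{cases}$$
   Context: For an abelian group $(G,+)$ of order $v\equiv 3\pmod 4$ and nonzero $\alpha,\beta\in G$, a $(G,\alpha,\beta)$-almost partitionable set, APS$(G,\alpha,\beta)$, is a set $\mathcal S$ of $(v-3)/4$ unordered pairs $\{x,y\}$ of elements of $G$ such that (1) $\bigcup_{\{x,y\}\in\mathcal S}\pm\{x,y\}=G\setminus\{0,\alpha,-\alpha\}$ and (2) $\bigcup_{\{x,y\}\in\mathcal S}\pm\{x-y,x+y\}=G\setminus\{0,\beta,-\beta\}$. When $G=\mathbb{Z}_v$ (integers modulo $v$) this is written APS$(v,\alpha,\beta)$. *)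

(* Defs.v *)
From HB Require Import structures.
From mathcomp Require Import all_boot all_order all_algebra.

Set Implicit Arguments.
Unset Strict Implicit.
Unset Printing Implicit Defensive.

Import GRing.Theory.
Local Open Scope ring_scope.

Section AlmostPartitionable.

Variable G : finZmodType.
Implicit Types (x y alpha beta : G) (A : {set G}) (S : {set {set G}}).

Definition pmset A : {set G} := A :|: [set - x | x in A].

(* The unions run over all (x, y) with {x, y} in S, so each pair of S is met in
   both orders; by [pmset_subadd_sym] the order does not matter.  This is meant
   for nonzero alpha, beta and #|G| = 3 mod 4, so the division by 4 is exact. *)
Definition is_APS alpha beta S : Prop :=
  [/\ #|S| = ((#|G| - 3) %/ 4)%N,
      forall P, P \in S -> #|P| = 2%N,
      \bigcup_(u : G * G | [set u.1; u.2] \in S) pmset [set u.1; u.2]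
        = [set: G] :\: [set 0; alpha; - alpha]
    & \bigcup_(u : G * G | [set u.1; u.2] \in S)
          pmset [set u.1 - u.2; u.1 + u.2]
        = [set: G] :\: [set 0; beta; - beta]].

Lemma pmset_subadd_sym x y :
  pmset [set x - y; x + y] = pmset [set y - x; y + x].
Proof.
apply/setP => z; rewrite /pmset !imsetU1 !imset_set1 !opprB (addrC y x) !inE.
by do !case: (_ == _).
Qed.

End AlmostPartitionable.

(* Main.v *)
Require Import Defs.
From Stdlib Require Import NArith.
From HB Require Import structures.
From mathcomp Require Import all_boot all_order all_algebra.
From mathcomp Require Import zify ring.

(* Necessity: the first condition writes the sum of all squares of G as
   2 alpha^2 + 2 sum (x^2 + y^2), the second one as
   2 beta^2 + 4 sum (x^2 + y^2), since (x - y)^2 + (x + y)^2 = 2 (x^2 + y^2).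
   Eliminating the sum over the pairs leaves
   2 (2 alpha^2 - beta^2) = sum of z^2 over Z_v.

   Sufficiency: multiplication by a unit and the change of sign of beta
   preserve the existence of an APS, so alpha may be taken to be a divisor of
   v.  Up to these symmetries the quadratic equation leaves 97 cases with
   v < 300, and each of them has an explicit solution. *)

Set Implicit Arguments.
Unset Strict Implicit.
Unset Printing Implicit Defensive.

Import GRing.Theory.
Local Open Scope ring_scope.

(** A count carries the proof. [signed a l] has [3 + 4 * size l] entries; when this is the order of
    the group, hitting every element already forces the entries to be distinct. Disjointness is
    therefore never checked separately, neither in the abstract argument nor for the explicit
    solutions. The case split comes from the closed form (v - 1) v (2 v - 1) / 6 of the sum of
    squares: it vanishes modulo v when 6 is invertible, and it is 2 (v / 3) modulo v when v = 3
    modulo 12. The factor 2 cancels because v is odd. A nonzero alpha is a unit times d = gcd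
    (alpha, v). With alpha = d fixed, the units congruent to 1 modulo v / d still act, and the table
    only has to meet each orbit of solutions beta under these units and the sign. Scaling respects
    the quadratic equation because the square of a unit is 1 modulo 3 when 3 divides v. That every
    orbit is met is decided by evaluating a boolean test for all 75 orders, in binary arithmetic
    because the residues of ['Z_v] are unary numbers. *)

Section PairLists.

(** * From sets of unordered pairs to lists of ordered pairs *)

Variable G : finZmodType.
Implicit Types (a b z : G) (u : G * G) (l : seq (G * G)).

Definition pm4 u : seq G := [:: u.1; u.2; - u.1; - u.2].

Definition subadd u : G * G := (u.1 - u.2, u.1 + u.2).

Definition signed a l : seq G := [:: 0; a; - a] ++ flatten (map pm4 l).

Definition covers a l := forall z, z \in signed a l.

Definition APS_list a b l :=
  [/\ (3 + 4 * size l)%N = #|G|, covers a l & covers b (map subadd l)].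

Lemma size_signed a l : size (signed a l) = (3 + 4 * size l)%N.
Proof.
rewrite size_cat; congr (_ + _)%N.
by elim: l => //= u l ->; rewrite mulnS.
Qed.

Lemma covers_uniq a l :
  (3 + 4 * size l)%N = #|G| -> covers a l -> uniq (signed a l).
Proof.
move=> szl cov.
apply: (leq_size_uniq (enum_uniq G)) => [z _|]; first exact: cov.
by rewrite size_signed szl cardE.
Qed.

Lemma covers_perm a l :
  (3 + 4 * size l)%N = #|G| -> covers a l -> perm_eq (signed a l) (enum G).
Proof.
move=> szl cov; apply: uniq_perm; [exact: covers_uniq | exact: enum_uniq |].
by move=> z; rewrite cov mem_enum.
Qed.

Lemma mem_signed a l z :
  (z \in signed a l) =
  (z \in [set 0; a; - a]) || has (fun u => z \in pm4 u) l.
Proof.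
rewrite mem_cat !inE -!orbA; congr [|| _, _, _ | _].
by elim: l => //= u l <-; rewrite -mem_cat.
Qed.

Lemma mem_pmset u z : (z \in pmset [set u.1; u.2]) = (z \in pm4 u).
Proof. by rewrite /pmset imsetU1 imset_set1 !inE -!orbA. Qed.

Lemma signed_uniq_notin a l u z :
  uniq (signed a l) -> u \in l -> z \in pm4 u -> z \notin [set 0; a; - a].
Proof.
rewrite cat_uniq => /and3P[_ /hasPn disj _] ul zu; apply/negP => za.
have /disj : z \in flatten (map pm4 l).
  by apply/flattenP; exists (pm4 u) => //; apply: map_f.
by move: za; rewrite !inE -!orbA => ->.
Qed.

Lemma set2_eqP (T : finType) (x y x' y' : T) :
  [set x; y] = [set x'; y'] -> (x = x' /\ y = y') \/ (x = y' /\ y = x').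
Proof.
move=> E.
have hx : x \in [set x'; y'] by rewrite -E set21.
have hy : y \in [set x'; y'] by rewrite -E set22.
have hx' : x' \in [set x; y] by rewrite E set21.
have hy' : y' \in [set x; y] by rewrite E set22.
move: hx hy hx' hy' => /set2P[->|->] /set2P[->|->] /set2P[] ? /set2P[] ?.
all: by subst; auto.
Qed.

(** The unions of [is_APS] meet each set [{x, y}] in both orders, while a list keeps only one of
    them. A map of pairs is usable for the comparison if its signed values do not depend on the
    order; for [subadd] a swap only changes the sign of the difference. *)
Definition pair_invariant (f : G * G -> G * G) := forall u u' z,
  [set u.1; u.2] = [set u'.1; u'.2] -> (z \in pm4 (f u)) = (z \in pm4 (f u')).

Lemma subadd_pair_invariant : pair_invariant subadd.
Proof.
move=> u u' z /set2_eqP[[e1 e2]|[e1 e2]]; rewrite /subadd e1 e2 //.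
by rewrite -!mem_pmset /= pmset_subadd_sym.
Qed.

Lemma id_pair_invariant : pair_invariant id.
Proof. by move=> u u' z E; rewrite -!mem_pmset E. Qed.

Section Union.

Variables (a : G) (l : seq (G * G)) (f : G * G -> G * G) (S : {set {set G}}).
Hypothesis f_inv : pair_invariant f.
Hypothesis S_l : S =i [seq [set u.1; u.2] | u <- l].

Let U := \bigcup_(u : G * G | [set u.1; u.2] \in S)
           pmset [set (f u).1; (f u).2].

Lemma mem_bigcup_pairs z : (z \in U) = has (fun u => z \in pm4 u) (map f l).
Proof.
rewrite has_map; apply/bigcupP/hasP => [[u]|[u ul zu]].
  rewrite S_l mem_pmset => /mapP[u' u'l /f_inv -> zu].
  by exists u'.
by exists u; rewrite ?mem_pmset // S_l; apply/mapP; exists u.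
Qed.

(** Serves both conditions of [is_APS], with [f := id] and [f := subadd]. From the union to the
    covering it is a mere complement law; the converse needs the count, by which no entry coming
    from a pair can fall into [[set 0; a; - a]]. *)
Lemma bigcup_covers : (3 + 4 * size l)%N = #|G| ->
  (U = [set: G] :\: [set 0; a; - a]) <-> covers a (map f l).
Proof.
move=> szl; split=> [E z|cov].
  by rewrite mem_signed -mem_bigcup_pairs E !in_setD in_setT andbT orbN.
have us : uniq (signed a (map f l)) by apply: covers_uniq; rewrite ?size_map.
apply/setP => z; rewrite mem_bigcup_pairs in_setD in_setT andbT.
apply/idP/idP => [/hasP[u ul zu]|/negPf zN].
  exact: signed_uniq_notin us ul zu.
by have := cov z; rewrite mem_signed zN.
Qed.

End Union.

(** Two pairs with the same underlying set would list [u.1] twice, and [u.1 = u.2] would be a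
    repetition inside [pm4 u]. This yields the cardinality of [S] and the size 2 of its members
    required by [is_APS]. *)
Lemma uniq_flatten_pm4 l : uniq (flatten (map pm4 l)) ->
  uniq [seq [set u.1; u.2] | u <- l] /\ {in l, forall u, u.1 != u.2}.
Proof.
elim: l => // u l IHl.
have -> : flatten (map pm4 (u :: l)) = pm4 u ++ flatten (map pm4 l) by [].
rewrite cat_uniq => /and3P[uu /hasPn disj /IHl[uS dl]]; split; last first.
  move=> u'; rewrite inE => /predU1P[->|]; last exact: dl.
  by move: uu; rewrite /= inE negb_or => /andP[/andP[]].
rewrite /= uS andbT; apply/negP => /mapP[u' u'l E].
have : u.1 \in pm4 u' by rewrite -mem_pmset -E mem_pmset mem_head.
move=> m; have /disj/negP[] : u.1 \in flatten (map pm4 l).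
  by apply/flattenP; exists (pm4 u') => //; apply: map_f.
exact: mem_head.
Qed.

Lemma is_APS_list a b : (#|G| = 3 %[mod 4])%N ->
  (exists S : {set {set G}}, is_APS a b S) <-> exists l, APS_list a b l.
Proof.
move=> G3; split=> [[S [cS S2 ca cb]]|[l [szl ca cb]]]; last first.
  have /uniq_flatten_pm4[uS dl] : uniq (flatten (map pm4 l)).
    by have := covers_uniq szl ca; rewrite cat_uniq => /and3P[].
  pose S := [set P in [seq [set u.1; u.2] | u <- l]].
  have Sl : S =i [seq [set u.1; u.2] | u <- l] by move=> P; rewrite inE.
  exists S; split.
  - rewrite (eq_card Sl) (card_uniqP uS) size_map; lia.
  - by move=> P; rewrite Sl => /mapP[u /dl du ->]; rewrite cards2 du.
  - by apply/(bigcup_covers a id_pair_invariant Sl szl); rewrite map_id.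
  - exact/(bigcup_covers b subadd_pair_invariant Sl szl).
(* An arbitrary ordering of each pair. The default [(0, 0)] is never reached on members of [S],
   since they have two elements. *)
pose pr (P : {set G}) := odflt (0, 0) [pick u | P == [set u.1; u.2]].
have prE P : P \in S -> P = [set (pr P).1; (pr P).2].
  move=> /S2/eqP/cards2P[x [y [_ ->]]]; rewrite /pr.
  by case: pickP => [u /eqP E //|/(_ (x, y))/=]; rewrite eqxx.
pose l := [seq pr P | P <- enum S].
have Sl : S =i [seq [set u.1; u.2] | u <- l].
  rewrite -map_comp => P; rewrite -[LHS]mem_enum.
  rewrite -[X in P \in X]map_id; congr (_ \in _).
  by apply/eq_in_map => Q; rewrite mem_enum => /prE.
(* The congruence modulo 4 makes the truncating division in [cS] exact. *)
have szl : (3 + 4 * size l)%N = #|G| by rewrite size_map -cardE cS; lia.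
exists l; split=> //.
  have := iffLR (bigcup_covers a id_pair_invariant Sl szl) ca.
  by rewrite map_id.
exact: iffLR (bigcup_covers b subadd_pair_invariant Sl szl) cb.
Qed.

(** Lets the later checks run over one representative of each class [{z, - z}]. *)
Lemma signed_opp a l z :
  (- z \in signed a l) = (z \in signed a l).
Proof.
rewrite !mem_signed; congr (_ || _).
  rewrite !inE oppr_eq0 eqr_opp eqr_oppLR.
  by do !case: (_ == _).
by apply: eq_has => u; rewrite !inE !eqr_opp !eqr_oppLR; do !case: (_ == _).
Qed.

Lemma APS_list_oppr a b l : APS_list a b l -> APS_list a (- b) l.
Proof.
case=> szl ca cb; split=> // z; have := cb z.
by rewrite !mem_signed opprK !inE -!orbA (orbCA (z == b)).
Qed.

End PairLists.

(** * Scaling by units, and the necessary condition *)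

Section Units.

Variable R : finComUnitRingType.
Implicit Types (a b c : R) (l : seq (R * R)).

Lemma covers_mul c a l : c \is a GRing.unit ->
  covers a l -> covers (c * a) [seq (c * u.1, c * u.2) | u <- l].
Proof.
move=> Uc cov z; have := cov (c^-1 * z).
have eqM x : (c^-1 * z == x) = (z == c * x).
  by apply/eqP/eqP => [<-|->]; rewrite ?mulKr ?mulVKr.
rewrite !mem_signed has_map !inE !eqM mulr0 mulrN.
congr (_ || _); apply: eq_has => u /=.
by rewrite !inE !eqM !mulrN.
Qed.

Lemma APS_list_mul c a b l : c \is a GRing.unit -> APS_list a b l ->
  APS_list (c * a) (c * b) [seq (c * u.1, c * u.2) | u <- l].
Proof.
move=> Uc [szl ca cb]; split; rewrite ?size_map //; first exact: covers_mul.
have := covers_mul Uc cb; rewrite -!map_comp; congr covers.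
by apply: eq_map => u; rewrite /subadd /= mulrBr mulrDr.
Qed.

(** By the count, the sum over the ring may be taken along [signed a l]. There [z] and [- z] have
    the same square, so [a] and each pair contribute twice. *)
Lemma covers_sum_sqr a l : (3 + 4 * size l)%N = #|R| -> covers a l ->
  \sum_(z : R) z ^+ 2 =
    2 * a ^+ 2 + 2 * \sum_(u <- l) (u.1 ^+ 2 + u.2 ^+ 2).
Proof.
move=> szl ca.
rewrite -big_enum -(perm_big _ (covers_perm szl ca)) /= big_cat /=.
rewrite !big_cons big_nil expr0n sqrrN /=; congr (_ + _); first by ring.
elim: l {szl ca} => [|u l IHl]; first by rewrite !big_nil mulr0.
by rewrite !big_cons /= IHl !sqrrN; ring.
Qed.

Lemma APS_list_sum_sqr a b l : APS_list a b l ->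
  \sum_(z : R) z ^+ 2 = 2 * (2 * a ^+ 2 - b ^+ 2).
Proof.
case=> szl ca cb; have Ea := covers_sum_sqr szl ca.
have := covers_sum_sqr (l := map (@subadd R) l) _ cb.
rewrite size_map big_map => /(_ szl) Eb.
have E : \sum_(u <- l) ((subadd u).1 ^+ 2 + (subadd u).2 ^+ 2) =
         2 * \sum_(u <- l) (u.1 ^+ 2 + u.2 ^+ 2).
  by rewrite big_distrr; apply: eq_bigr => u _ /=; ring.
(* The sum is twice itself minus itself. The first copy is expanded through [a], the second through
   [b]; both produce four times the sum over the pairs, which cancels without any division by 2. *)
transitivity (2 * (\sum_(z : R) z ^+ 2) - \sum_(z : R) z ^+ 2); first by ring.
by rewrite {1}Ea Eb E; ring.
Qed.

End Units.

(** * Elementary arithmetic modulo v: the sum of squares, and residues as units times divisors *)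

Lemma sum_sqr_nat n : (6 * \sum_(i < n) i ^ 2 = n.-1 * n * (2 * n).-1)%N.
Proof.
elim: n => [|n IHn]; first by rewrite big_ord0.
rewrite big_ord_recr mulnDr IHn; case: n {IHn} => //= n; lia.
Qed.

(** Under the congruence modulo 4, either 3 divides [v], which then is 3 modulo 12, or [v] is
    coprime to 6. In the latter case [v] divides [6 * s] by the closed formula, and the 6 can be
    removed. The factor 2 is kept apart to match [APS_list_sum_sqr]. *)
Lemma sum_sqr_Zp v : (v = 3 %[mod 4])%N ->
  \sum_(z : 'Z_v) z ^+ 2 =
    2 * (if (v == 3 %[mod 12])%N then (v %/ 3)%:R else 0).
Proof.
move=> v3; have v_gt1 : (1 < v)%N by lia.
have -> : \sum_(z : 'Z_v) z ^+ 2 = (\sum_(i < v) i ^ 2)%N%:R :> 'Z_v.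
  rewrite natr_sum -(big_mkord xpredT (fun i => (i ^ 2)%:R : 'Z_v)).
  rewrite -[X in \sum_(0 <= i < X) _](Zp_cast v_gt1) big_mkord.
  apply: eq_bigr => i _.
  by rewrite natrX natr_Zp.
have := sum_sqr_nat v; set s := (\sum_(i < v) _)%N => Es.
case: ifP => v12.
  have [j vE] : exists j, v = (12 * j + 3)%N by exists (v %/ 12)%N; lia.
  (* For v = 12 j + 3 the closed formula is s = (6 j + 1) (4 j + 1) (24 j + 5). Subtracting 2 (4 j +
     1) leaves 4 j + 1 times 3 (48 j^2 + 18 j + 1), a multiple of v. *)
  have -> : s = ((2 * (v %/ 3)) + v * (48 * j ^ 2 + 18 * j + 1))%N.
    have -> : (v %/ 3 = 4 * j + 1)%N by lia.
    apply/eqP; rewrite -(eqn_pmul2l (isT : 0 < 6)%N) Es vE; apply/eqP.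
    have -> : ((12 * j + 3).-1 = 12 * j + 2)%N by lia.
    have -> : ((2 * (12 * j + 3)).-1 = 24 * j + 5)%N by lia.
    ring.
  by rewrite natrD !natrM pchar_Zp // mul0r addr0.
have v6 : coprime v 6.
  by rewrite (coprimeMr v 2 3) coprimen2 coprime_sym prime_coprime //; lia.
have : (v %| 6 * s)%N by rewrite Es -mulnA dvdn_mull // dvdn_mulr.
rewrite Gauss_dvdr // => /dvdnP[q ->].
by rewrite natrM pchar_Zp // !mulr0.
Qed.

(** The witness is [k] plus [m] times the part of [v] made of the primes that do not divide [k]. A
    prime factor of [v] that divides [k] divides neither [m] nor this part; one that does not divide
    [k] divides this part. Either way it divides exactly one of the two summands, hence not [u]. *)
Lemma coprime_lift v k m : (0 < v)%N -> coprime k m ->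
  exists2 u, coprime v u & u = k %[mod m].
Proof.
move=> v_gt0 km; pose pi := [pred p | ~~ (p %| k)%N].
exists (k + m * v`_pi)%N; last by rewrite addnC mulnC modnMDl.
rewrite /coprime; set g := gcdn _ _; apply/negPn/negP => g_neq1.
have g_gt0 : (0 < g)%N by rewrite gcdn_gt0 v_gt0.
have p_prime : prime (pdiv g) by rewrite pdiv_prime //; lia.
have /[!dvdn_gcd]/andP[pv pu] := pdiv_dvd g.
move: (pdiv g) p_prime pv pu => p p_prime pv.
have p_part : (p %| v`_pi)%N = ~~ (p %| k)%N.
  have := pi_of_part pi v_gt0 p.
  rewrite !inE !mem_primes p_prime part_gt0 v_gt0 pv /=.
  by move=> ->.
have [pk|pk] := boolP (p %| k)%N; last first.
  by rewrite dvdn_addl ?(negPf pk) // dvdn_mull // p_part.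
rewrite dvdn_addr // Euclid_dvdM // p_part pk orbF => pm.
have : (p %| gcdn k m)%N by rewrite dvdn_gcd pk.
by rewrite (eqP km) Euclid_dvd1.
Qed.

(** With [d] the gcd of [a] and [v], the quotient [a / d] is prime to [v / d]. Multiplication by [d]
    only sees its class modulo [v / d], so it can be replaced by a lift prime to [v]. *)
Lemma Zp_associate_divisor v (a : 'Z_v) : (1 < v)%N -> a != 0 ->
  exists2 d, (0 < d < v)%N && (d %| v)%N &
  exists2 u, coprime v u & a = u%:R * d%:R.
Proof.
move=> v_gt1 a_neq0.
have av : (a < v)%N by rewrite -[X in (_ < X)%N](Zp_cast v_gt1) ltn_ord.
have a_gt0 : (0 < a)%N by rewrite lt0n.
pose d := gcdn a v.
have d_gt0 : (0 < d)%N by rewrite gcdn_gt0 a_gt0.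
exists d.
  have := dvdn_leq a_gt0 (dvdn_gcdl a v).
  by rewrite d_gt0 dvdn_gcdr andbT -/d; lia.
have [u uv um] : exists2 u, coprime v u & u = (a %/ d)%N %[mod v %/ d].
  apply: coprime_lift; first by lia.
  rewrite /coprime -(eqn_pmul2r d_gt0) muln_gcdl mul1n.
  by rewrite !divnK ?dvdn_gcdl ?dvdn_gcdr.
exists u => //; rewrite -natrM -[LHS]natr_Zp -[LHS](Zp_nat_mod v_gt1).
rewrite -[RHS](Zp_nat_mod v_gt1); congr _%:R.
rewrite -[in RHS](divnK (dvdn_gcdr a v)) -/d -muln_modl um muln_modl.
by rewrite !divnK ?dvdn_gcdl ?dvdn_gcdr.
Qed.

(** * Residues as binary numbers, and the checking of certificates *)

Definition nums n : seq N := map bin_of_nat (iota 1 n).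

Lemma mem_nums n (i : N) : (i \in nums n) = (0 < i <= n)%N.
Proof.
rewrite -[i in LHS]nat_of_binK mem_map ?mem_iota; first by lia.
exact: can_inj bin_of_natK.
Qed.

Section BinaryResidues.

Variable v : N.

Definition Zres (n : N) : 'Z_v := (nat_of_bin n)%:R.

Lemma Zres_of_nat n : Zres (bin_of_nat n) = n%:R.
Proof. by rewrite /Zres bin_of_natK. Qed.

Lemma ZresD m n : Zres (m + n) = Zres m + Zres n.
Proof. by rewrite /Zres -natrD; congr _%:R; lia. Qed.

Lemma ZresM m n : Zres (m * n) = Zres m * Zres n.
Proof. by rewrite /Zres -natrM; congr _%:R; lia. Qed.

Lemma ZresB m n : N.leb n m -> Zres (m - n) = Zres m - Zres n.
Proof. by move=> nm; rewrite /Zres -natrB; [congr _%:R|]; lia. Qed.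

Lemma nat_of_bin_mod n : (0 < v)%N -> nat_of_bin (N.modulo n v) = (n %% v)%N.
Proof.
move=> v_gt0; have := N.div_mod n v; have := N.mod_lt n v.
set q := N.div _ _; set r := N.modulo _ _ => h1 h2.
have rn : (r < v)%N by lia.
have E : (n = q * v + r :> nat)%N by lia.
by rewrite E modnMDl modn_small.
Qed.

Hypothesis v_gt1 : (1 < v)%N.

Lemma Zres_v : Zres v = 0.
Proof. by rewrite /Zres pchar_Zp. Qed.

Lemma eq_Zres m n : (Zres m == Zres n) = N.eqb (N.modulo m v) (N.modulo n v).
Proof.
have -> : N.eqb (N.modulo m v) (N.modulo n v) =
          (nat_of_bin (N.modulo m v) == nat_of_bin (N.modulo n v)) by lia.
by rewrite !(nat_of_bin_mod _ (ltnW v_gt1)) -val_eqE /= !val_Zp_nat.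
Qed.

Lemma Zp_sign_half (z : 'Z_v) : z != 0 ->
  exists2 i, i \in nums (N.div2 v) & z = Zres i \/ z = - Zres i.
Proof.
move=> z_neq0.
have zv : (z < v)%N by rewrite -[X in (_ < X)%N](Zp_cast v_gt1) ltn_ord.
have z_gt0 : (0 < z)%N by rewrite lt0n.
(* For either parity of [v], if [z] exceeds [N.div2 v] then [v - z] does not. *)
have half : (nat_of_bin (N.div2 v)).*2.+1 = v \/ (nat_of_bin (N.div2 v)).*2 = v.
  have := N.div2_odd v; move: (N.div2 v) => h.
  by case: (N.odd v); rewrite /N.b2n => ->; lia.
have [zh|zh] := leqP z (N.div2 v).
  exists (bin_of_nat z); last by left; rewrite Zres_of_nat natr_Zp.
  by rewrite mem_nums bin_of_natK z_gt0.
exists (bin_of_nat (v - z)); first by rewrite mem_nums bin_of_natK; lia.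
right; rewrite Zres_of_nat natrB; last exact: ltnW.
by rewrite pchar_Zp // sub0r opprK natr_Zp.
Qed.

(** The comparison is literal equality in [N], without reduction modulo [v]: [s] has to contain the
    representatives in the lower half themselves. *)
Definition hits (s : seq N) : bool :=
  all (fun i => has (N.eqb i) s) (nums (N.div2 v)).

Lemma hits_covers (s : seq N) a l :
  hits s -> (forall i, i \in s -> Zres i \in signed a l) -> covers a l.
Proof.
move=> /allP hs sub z.
have [->|/Zp_sign_half[i /hs/hasP[j js /N.eqb_eq ->]]] := eqVneq z 0.
  by rewrite mem_signed !inE eqxx.
by move=> [] ->; rewrite ?signed_opp sub.
Qed.

End BinaryResidues.

(* [(v, a, b, l)]: the pairs of l form an APS(v, a, b), every class {z, -z}
   being represented in 1 .. (v - 1) / 2 *)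
Definition certificate : Type := N * N * N * seq (N * N).

(** For entries in 1 .. (v - 1) / 2 these are the lower-half representatives, up to sign, of the
    difference and the sum, in the form that [hits] looks for. [N.max] and [N.min] give the absolute
    difference although the subtraction of [N] truncates. *)
Definition fold_subadd (v : N) (u : N * N) : seq N :=
  [:: N.max u.1 u.2 - N.min u.1 u.2; N.min (u.1 + u.2) (v - (u.1 + u.2))]%num.

(** The size test supplies the count that turns a covering into a partition; the bound on
    [u.1 + u.2] keeps [v - (u.1 + u.2)] from truncating. *)
Definition certificate_ok (c : certificate) : bool :=
  let: (v, a, b, l) := c in
  [&& N.eqb (bin_of_nat (3 + 4 * size l)) v,
      all (fun u => N.leb (u.1 + u.2) v) l,
      hits v (a :: flatten [seq [:: u.1; u.2] | u <- l])
    & hits v (b :: flatten [seq fold_subadd v u | u <- l])].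

Lemma certificate_APS v a b l : certificate_ok (v, a, b, l) ->
  APS_list (Zres v a) (Zres v b) [seq (Zres v u.1, Zres v u.2) | u <- l].
Proof.
case/and4P => szl /allP sum_le /hits_covers ha /hits_covers hb.
have szl' : (3 + 4 * size l)%N = v by lia.
have v_gt1 : (1 < v)%N by lia.
split; first by rewrite size_map card_ord Zp_cast.
- apply: ha => // i; rewrite inE mem_signed => /predU1P[->|].
    by rewrite !inE eqxx orbT.
  case/flattenP => _ /mapP[u ul ->] iu; rewrite has_map; apply/orP; right.
  apply/hasP; exists u => //.
  by move: iu; rewrite !inE => /orP[] /eqP ->; rewrite eqxx ?orbT.
- apply: hb => // i; rewrite inE mem_signed => /predU1P[->|].
    by rewrite !inE eqxx orbT.
  case/flattenP => _ /mapP[u ul ->] iu; rewrite -map_comp has_map.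
  apply/orP; right.
  apply/hasP; exists u => //.
  have := sum_le u ul; case: u {ul} iu => x y; rewrite !inE /= => iu le_v.
  have [{}iu|{}iu] := orP iu; move/eqP: iu => ->.
  (* Folding may have changed the sign; [pm4] contains both signs. *)
  + have [xy|yx] : N.leb x y \/ N.leb y x by lia.
      have -> : (N.max x y - N.min x y = y - x)%num by lia.
      by rewrite ZresB // opprB eqxx !orbT.
    have -> : (N.max x y - N.min x y = x - y)%num by lia.
    by rewrite ZresB // eqxx.
  + have [->|->] : N.min (x + y) (v - (x + y)) = (x + y)%num \/
                   N.min (x + y) (v - (x + y)) = (v - (x + y))%num by lia.
      by rewrite ZresD eqxx orbT.
    by rewrite ZresB // Zres_v // sub0r ZresD eqxx !orbT.
Qed.

(* found by a randomized local search *)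
Definition certificates : seq certificate := [::
  (3, 1, 1, [::]);
  (7, 1, 3, [:: (2,3)]);
  (23, 1, 5, [:: (2,8); (3,6); (4,11); (5,7); (9,10)]);
  (27, 3, 3, [:: (1,10); (2,8); (4,9); (5,7); (6,13); (11,12)]);
  (27, 3, 6, [:: (1,11); (2,9); (4,5); (6,8); (7,12); (10,13)]);
  (27, 3, 12, [:: (1,10); (2,4); (5,12); (6,7); (8,11); (9,13)]);
  (31, 1, 8, [:: (2,5); (3,12); (4,14); (6,8); (7,13); (9,10); (11,15)]);
  (35, 5, 15, [:: (1,7); (2,9); (3,16); (4,13); (6,8); (10,15); (11,12);
   (14,17)]);
  (39, 13, 13, [:: (1,10); (2,18); (3,7); (4,11); (5,17); (6,8); (9,12);
   (14,19); (15,16)]);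
  (47, 1, 7, [:: (2,21); (3,11); (4,17); (5,10); (6,16); (7,9); (8,19);
   (12,18); (13,22); (14,15); (20,23)]);
  (51, 1, 6, [:: (2,11); (3,20); (4,18); (5,13); (6,9); (7,23); (8,19);
   (10,22); (12,14); (15,16); (17,24); (21,25)]);
  (51, 3, 1, [:: (1,14); (2,8); (4,23); (5,25); (6,20); (7,9); (10,13);
   (11,18); (12,21); (15,19); (16,24); (17,22)]);
  (71, 1, 12, [:: (2,34); (3,5); (4,13); (6,9); (7,27); (8,15); (10,31);
   (11,33); (12,28); (14,24); (16,30); (17,35); (18,29); (19,23); (20,25);
   (21,22); (26,32)]);
  (75, 5, 5, [:: (1,18); (2,11); (3,35); (4,26); (6,20); (7,28); (8,16);
   (9,24); (10,37); (12,22); (13,33); (14,17); (15,21); (19,31); (23,34);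
   (25,27); (29,30); (32,36)]);
  (75, 5, 10, [:: (1,34); (2,26); (3,29); (4,17); (6,8); (7,24); (9,32);
   (10,15); (11,27); (12,18); (13,14); (16,23); (19,37); (20,35); (21,25);
   (22,31); (28,36); (30,33)]);
  (75, 5, 20, [:: (1,18); (2,8); (3,10); (4,37); (6,32); (7,29); (9,36);
   (11,20); (12,13); (14,26); (15,17); (16,31); (19,35); (21,25); (22,30);
   (23,34); (24,27); (28,33)]);
  (75, 5, 25, [:: (1,2); (3,29); (4,19); (6,14); (7,9); (8,36); (10,23);
   (11,28); (12,34); (13,27); (15,26); (16,35); (17,21); (18,30); (20,25);
   (22,32); (24,33); (31,37)]);
  (75, 5, 35, [:: (1,37); (2,8); (3,21); (4,13); (6,20); (7,27); (9,14);
   (10,23); (11,36); (12,31); (15,16); (17,28); (18,30); (19,34); (22,24);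
   (25,29); (26,33); (32,35)]);
  (75, 25, 5, [:: (1,3); (2,5); (4,32); (6,26); (7,23); (8,19); (9,35);
   (10,31); (11,12); (13,22); (14,24); (15,27); (16,30); (17,36); (18,33);
   (20,37); (21,29); (28,34)]);
  (75, 25, 25, [:: (1,3); (2,35); (4,31); (5,13); (6,37); (7,16); (8,11);
   (9,21); (10,26); (12,22); (14,15); (17,32); (18,29); (19,36); (20,33);
   (23,28); (24,30); (27,34)]);
  (79, 1, 9, [:: (2,13); (3,33); (4,20); (5,28); (6,25); (7,34); (8,29);
   (9,11); (10,18); (12,22); (14,21); (15,32); (16,38); (17,23); (19,31);
   (24,37); (26,27); (30,35); (36,39)]);
  (91, 13, 39, [:: (1,44); (2,12); (3,27); (4,5); (6,26); (7,19); (8,43);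
   (9,32); (10,21); (11,38); (14,22); (15,18); (16,31); (17,45); (20,37);
   (23,30); (24,42); (25,29); (28,41); (33,39); (34,36); (35,40)]);
  (103, 1, 38, [:: (2,7); (3,42); (4,21); (5,15); (6,41); (8,38); (9,35);
   (10,11); (12,25); (13,37); (14,47); (16,32); (17,19); (18,33); (20,43);
   (22,50); (23,31); (24,36); (26,45); (27,49); (28,34); (29,40); (30,44);
   (39,46); (48,51)]);
  (111, 37, 37, [:: (1,3); (2,24); (4,40); (5,23); (6,47); (7,54); (8,9);
   (10,17); (11,51); (12,42); (13,55); (14,19); (15,36); (16,32); (18,21);
   (20,35); (22,30); (25,48); (26,39); (27,52); (28,38); (29,53); (31,45);
   (33,44); (34,46); (41,50); (43,49)]);
  (115, 5, 25, [:: (1,37); (2,52); (3,18); (4,33); (6,17); (7,27); (8,38);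
   (9,23); (10,14); (11,51); (12,29); (13,46); (15,28); (16,47); (19,54);
   (20,48); (21,43); (22,49); (24,36); (25,41); (26,31); (30,40); (32,35);
   (34,42); (39,57); (44,45); (50,56); (53,55)]);
  (119, 1, 11, [:: (2,57); (3,34); (4,26); (5,9); (6,41); (7,36); (8,44);
   (10,29); (11,35); (12,38); (13,40); (14,30); (15,56); (16,49); (17,23);
   (18,39); (19,37); (20,48); (21,24); (22,27); (25,33); (28,53); (31,46);
   (32,55); (42,43); (45,54); (47,59); (50,52); (51,58)]);
  (119, 1, 45, [:: (2,16); (3,20); (4,43); (5,55); (6,14); (7,41); (8,27);
   (9,47); (10,17); (11,21); (12,42); (13,54); (15,36); (18,58); (19,56);
   (22,44); (23,32); (24,25); (26,51); (28,30); (29,33); (31,57); (34,49);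
   (35,38); (37,53); (39,52); (40,46); (45,50); (48,59)]);
  (119, 7, 42, [:: (1,3); (2,46); (4,12); (5,32); (6,59); (8,51); (9,31);
   (10,42); (11,14); (13,43); (15,20); (16,45); (17,38); (18,27); (19,30);
   (21,36); (22,28); (23,57); (24,48); (25,58); (26,52); (29,39); (33,40);
   (34,47); (35,53); (37,54); (41,55); (44,56); (49,50)]);
  (119, 17, 51, [:: (1,26); (2,32); (3,21); (4,59); (5,8); (6,52); (7,29);
   (9,48); (10,19); (11,37); (12,47); (13,28); (14,30); (15,57); (16,53);
   (18,20); (22,45); (23,51); (24,25); (27,38); (31,35); (33,54); (34,42);
   (36,43); (39,49); (40,46); (41,58); (44,56); (50,55)]);
  (123, 1, 24, [:: (2,5); (3,45); (4,55); (6,31); (7,42); (8,21); (9,18);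
   (10,33); (11,29); (12,50); (13,47); (14,36); (15,32); (16,52); (17,37);
   (19,51); (20,24); (22,34); (23,54); (25,53); (26,40); (27,57); (28,43);
   (30,35); (38,44); (39,58); (41,49); (46,56); (48,59); (60,61)]);
  (123, 3, 10, [:: (1,19); (2,10); (4,20); (5,37); (6,40); (7,58); (8,17);
   (9,26); (11,34); (12,59); (13,54); (14,47); (15,51); (16,43); (18,56);
   (21,22); (23,60); (24,46); (25,30); (27,33); (28,41); (29,50); (31,42);
   (32,61); (35,49); (36,39); (38,57); (44,48); (45,52); (53,55)]);
  (127, 1, 16, [:: (2,22); (3,63); (4,25); (5,54); (6,19); (7,10); (8,27);
   (9,21); (11,47); (12,53); (13,59); (14,61); (15,38); (16,48); (17,23);
   (18,20); (24,52); (26,57); (28,42); (29,55); (30,41); (31,46); (32,50);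
   (33,60); (34,56); (35,44); (36,37); (39,49); (40,45); (43,51); (58,62)]);
  (135, 15, 45, [:: (1,62); (2,14); (3,36); (4,53); (5,29); (6,19); (7,55);
   (8,48); (9,17); (10,12); (11,58); (13,63); (16,21); (18,59); (20,24);
   (22,42); (23,30); (25,40); (26,49); (27,65); (28,56); (31,50); (32,35);
   (33,47); (34,66); (37,46); (38,67); (39,60); (41,52); (43,61); (44,45);
   (51,57); (54,64)]);
  (135, 45, 15, [:: (1,21); (2,38); (3,60); (4,49); (5,24); (6,19); (7,41);
   (8,18); (9,42); (10,27); (11,66); (12,54); (13,34); (14,57); (15,47);
   (16,40); (17,35); (20,48); (22,52); (23,62); (25,29); (26,33); (28,37);
   (30,61); (31,58); (32,43); (36,50); (39,55); (44,56); (46,51); (53,59);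
   (63,64); (65,67)]);
  (147, 1, 10, [:: (2,18); (3,27); (4,13); (5,61); (6,32); (7,62); (8,72);
   (9,23); (10,49); (11,73); (12,19); (14,68); (15,38); (16,60); (17,35);
   (20,53); (21,24); (22,57); (25,26); (28,47); (29,58); (30,71); (31,39);
   (33,67); (34,56); (36,63); (37,52); (40,65); (41,69); (42,44); (43,55);
   (45,66); (46,51); (48,59); (50,54); (64,70)]);
  (147, 1, 59, [:: (2,13); (3,25); (4,56); (5,37); (6,47); (7,33); (8,65);
   (9,40); (10,48); (11,57); (12,31); (14,15); (16,61); (17,20); (18,68);
   (19,36); (21,35); (22,49); (23,59); (24,42); (26,73); (27,51); (28,44);
   (29,64); (30,55); (32,52); (34,46); (38,45); (39,69); (41,62); (43,53);
   (50,63); (54,60); (58,66); (67,71); (70,72)]);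
  (147, 7, 7, [:: (1,13); (2,59); (3,28); (4,24); (5,63); (6,60); (8,51);
   (9,64); (10,52); (11,19); (12,41); (14,18); (15,65); (16,17); (20,29);
   (21,55); (22,48); (23,42); (25,38); (26,61); (27,68); (30,69); (31,33);
   (32,70); (34,44); (35,72); (36,39); (37,54); (40,56); (43,58); (45,66);
   (46,57); (47,53); (49,71); (50,73); (62,67)]);
  (147, 7, 14, [:: (1,9); (2,13); (3,23); (4,43); (5,22); (6,29); (8,73);
   (10,38); (11,72); (12,28); (14,39); (15,61); (16,52); (17,68); (18,59);
   (19,56); (20,64); (21,53); (24,66); (25,34); (26,32); (27,65); (30,63);
   (31,36); (33,54); (35,69); (37,41); (40,62); (42,55); (44,51); (45,46);
   (47,71); (48,50); (49,67); (57,60); (58,70)]);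
  (147, 7, 28, [:: (1,3); (2,10); (4,51); (5,8); (6,32); (9,54); (11,47);
   (12,44); (13,62); (14,37); (15,29); (16,27); (17,69); (18,59); (19,38);
   (20,53); (21,46); (22,56); (23,41); (24,64); (25,60); (26,55); (28,48);
   (30,67); (31,70); (33,49); (34,65); (35,52); (36,58); (39,40); (42,63);
   (43,50); (45,72); (57,66); (61,71); (68,73)]);
  (147, 7, 35, [:: (1,27); (2,5); (3,58); (4,18); (6,65); (8,71); (9,41);
   (10,39); (11,12); (13,33); (14,51); (15,26); (16,67); (17,55); (19,21);
   (20,73); (22,52); (23,54); (24,36); (25,44); (28,72); (29,62); (30,69);
   (31,35); (32,57); (34,61); (37,43); (38,47); (40,50); (42,60); (45,66);
   (46,59); (48,56); (49,64); (53,70); (63,68)]);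
  (147, 7, 49, [:: (1,36); (2,17); (3,24); (4,26); (5,72); (6,8); (9,41);
   (10,52); (11,70); (12,40); (13,61); (14,57); (15,71); (16,49); (18,28);
   (19,45); (20,67); (21,37); (22,29); (23,34); (25,50); (27,51); (30,64);
   (31,32); (33,46); (35,73); (38,55); (39,68); (42,60); (43,63); (44,48);
   (47,56); (53,58); (54,62); (59,65); (66,69)]);
  (147, 7, 56, [:: (1,33); (2,52); (3,73); (4,61); (5,42); (6,34); (8,31);
   (9,54); (10,71); (11,24); (12,13); (14,65); (15,21); (16,62); (17,36);
   (18,44); (19,39); (20,28); (22,27); (23,41); (25,67); (26,47); (29,38);
   (30,57); (32,56); (35,37); (40,69); (43,60); (45,59); (46,49); (48,58);
   (50,66); (51,63); (53,64); (55,70); (68,72)]);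
  (147, 7, 70, [:: (1,39); (2,21); (3,30); (4,64); (5,56); (6,42); (8,45);
   (9,48); (10,31); (11,54); (12,62); (13,16); (14,20); (15,61); (17,71);
   (18,46); (19,33); (22,44); (23,35); (24,32); (25,50); (26,41); (27,51);
   (28,70); (29,34); (36,67); (37,55); (38,47); (40,60); (43,69); (49,53);
   (52,63); (57,73); (58,59); (65,72); (66,68)]);
  (147, 49, 7, [:: (1,61); (2,13); (3,40); (4,17); (5,62); (6,50); (7,21);
   (8,10); (9,41); (11,44); (12,57); (14,68); (15,55); (16,67); (18,35);
   (19,29); (20,46); (22,51); (23,24); (25,47); (26,45); (27,31); (28,58);
   (30,71); (32,66); (33,72); (34,54); (36,48); (37,42); (38,73); (39,70);
   (43,52); (53,69); (56,64); (59,65); (60,63)]);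
  (147, 49, 49, [:: (1,2); (3,44); (4,71); (5,23); (6,46); (7,14); (8,56);
   (9,26); (10,60); (11,67); (12,70); (13,29); (15,48); (16,39); (17,19);
   (18,43); (20,51); (21,25); (22,52); (24,69); (27,32); (28,40); (30,36);
   (31,63); (33,57); (34,53); (35,50); (37,59); (38,72); (41,68); (42,62);
   (45,58); (47,61); (54,64); (55,66); (65,73)]);
  (151, 1, 46, [:: (2,16); (3,70); (4,37); (5,49); (6,34); (7,73); (8,24);
   (9,59); (10,52); (11,63); (12,36); (13,14); (15,71); (17,62); (18,41);
   (19,44); (20,29); (21,60); (22,33); (23,30); (25,35); (26,31); (27,48);
   (28,54); (32,68); (38,75); (39,69); (40,53); (42,45); (43,47); (46,58);
   (50,72); (51,66); (55,61); (56,64); (57,74); (65,67)]);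
  (155, 5, 40, [:: (1,22); (2,29); (3,6); (4,18); (7,12); (8,37); (9,64);
   (10,58); (11,61); (13,67); (14,20); (15,45); (16,49); (17,52); (19,66);
   (21,53); (23,74); (24,35); (25,69); (26,65); (27,51); (28,48); (30,76);
   (31,68); (32,34); (33,59); (36,77); (38,50); (39,54); (40,44); (41,57);
   (42,70); (43,60); (46,71); (47,55); (56,63); (62,75); (72,73)]);
  (167, 1, 13, [:: (2,17); (3,27); (4,41); (5,30); (6,44); (7,36); (8,50);
   (9,80); (10,51); (11,59); (12,14); (13,47); (15,25); (16,82); (18,65);
   (19,68); (20,71); (21,74); (22,81); (23,54); (24,57); (26,42); (28,34);
   (29,83); (31,63); (32,43); (33,55); (35,58); (37,73); (38,77); (39,46);
   (40,60); (45,66); (48,56); (49,53); (52,69); (61,62); (64,76); (67,72);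
   (70,79); (75,78)]);
  (175, 5, 15, [:: (1,73); (2,80); (3,78); (4,53); (6,40); (7,18); (8,77);
   (9,50); (10,28); (11,41); (12,16); (13,14); (15,25); (17,82); (19,79);
   (20,63); (21,26); (22,42); (23,86); (24,30); (27,46); (29,85); (31,64);
   (32,54); (33,72); (34,37); (35,56); (36,60); (38,69); (39,83); (43,45);
   (44,76); (47,61); (48,65); (49,75); (51,87); (52,81); (55,62); (57,70);
   (58,67); (59,71); (66,74); (68,84)]);
  (175, 5, 20, [:: (1,38); (2,44); (3,8); (4,64); (6,25); (7,57); (9,26);
   (10,65); (11,73); (12,33); (13,66); (14,81); (15,62); (16,32); (17,55);
   (18,70); (19,78); (20,34); (21,49); (22,51); (23,48); (24,75); (27,39);
   (28,86); (29,36); (30,71); (31,61); (35,58); (37,69); (40,46); (41,85);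
   (42,52); (43,47); (45,67); (50,68); (53,79); (54,87); (56,83); (59,60);
   (63,72); (74,77); (76,84); (80,82)]);
  (175, 5, 50, [:: (1,45); (2,43); (3,62); (4,84); (6,16); (7,63); (8,41);
   (9,15); (10,57); (11,20); (12,50); (13,64); (14,22); (17,75); (18,72);
   (19,67); (21,58); (23,34); (24,42); (25,86); (26,47); (27,80); (28,48);
   (29,46); (30,73); (31,32); (33,68); (35,49); (36,61); (37,56); (38,77);
   (39,55); (40,66); (44,76); (51,53); (52,81); (54,69); (59,82); (60,87);
   (65,70); (71,74); (78,85); (79,83)]);
  (175, 5, 55, [:: (1,7); (2,38); (3,62); (4,11); (6,52); (8,42); (9,35);
   (10,86); (12,26); (13,41); (14,55); (15,48); (16,73); (17,68); (18,85);
   (19,58); (20,81); (21,45); (22,82); (23,65); (24,29); (25,56); (27,57);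
   (28,50); (30,53); (31,80); (32,43); (33,60); (34,46); (36,37); (39,74);
   (40,83); (44,63); (47,72); (49,78); (51,54); (59,69); (61,77); (64,66);
   (67,76); (70,87); (71,84); (75,79)]);
  (175, 5, 85, [:: (1,44); (2,79); (3,45); (4,22); (6,41); (7,47); (8,68);
   (9,19); (10,13); (11,75); (12,17); (14,77); (15,64); (16,72); (18,50);
   (20,51); (21,76); (23,36); (24,58); (25,55); (26,32); (27,39); (28,37);
   (29,54); (30,71); (31,82); (33,40); (34,84); (35,73); (38,62); (42,61);
   (43,80); (46,60); (48,81); (49,65); (52,53); (56,83); (57,74); (59,63);
   (66,87); (67,69); (70,85); (78,86)]);
  (175, 25, 5, [:: (1,54); (2,67); (3,51); (4,70); (5,32); (6,62); (7,78);
   (8,87); (9,52); (10,82); (11,46); (12,14); (13,16); (15,31); (17,27);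
   (18,42); (19,40); (20,53); (21,41); (22,64); (23,74); (24,39); (26,65);
   (28,36); (29,76); (30,58); (33,44); (34,83); (35,47); (37,71); (38,56);
   (43,57); (45,85); (48,86); (49,50); (55,68); (59,66); (60,79); (61,84);
   (63,80); (69,75); (72,81); (73,77)]);
  (175, 25, 75, [:: (1,59); (2,69); (3,62); (4,73); (5,19); (6,41); (7,24);
   (8,70); (9,63); (10,39); (11,26); (12,67); (13,77); (14,66); (15,51);
   (16,37); (17,21); (18,28); (20,22); (23,68); (27,78); (29,45); (30,56);
   (31,32); (33,81); (34,53); (35,47); (36,58); (38,61); (40,43); (42,83);
   (44,74); (46,86); (48,54); (49,82); (50,57); (52,84); (55,64); (60,87);
   (65,76); (71,79); (72,85); (75,80)]);
  (175, 35, 35, [:: (1,5); (2,39); (3,65); (4,68); (6,72); (7,9); (8,75);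
   (10,55); (11,74); (12,46); (13,37); (14,43); (15,59); (16,24); (17,70);
   (18,25); (19,61); (20,29); (21,49); (22,60); (23,54); (26,73); (27,52);
   (28,33); (30,45); (31,63); (32,84); (34,85); (36,53); (38,64); (40,51);
   (41,80); (42,78); (44,62); (47,57); (48,67); (50,77); (56,86); (58,71);
   (66,87); (69,83); (76,79); (81,82)]);
  (175, 35, 70, [:: (1,53); (2,5); (3,56); (4,79); (6,44); (7,38); (8,55);
   (9,30); (10,77); (11,67); (12,86); (13,24); (14,71); (15,61); (16,28);
   (17,49); (18,43); (19,29); (20,75); (21,41); (22,50); (23,59); (25,54);
   (26,42); (27,62); (31,40); (32,74); (33,82); (34,60); (36,37); (39,45);
   (46,64); (47,87); (48,63); (51,81); (52,65); (57,84); (58,66); (68,85);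
   (69,83); (70,72); (73,78); (76,80)]);
  (183, 61, 61, [:: (1,65); (2,28); (3,40); (4,27); (5,80); (6,50); (7,34);
   (8,44); (9,15); (10,38); (11,78); (12,13); (14,82); (16,74); (17,37);
   (18,83); (19,26); (20,89); (21,60); (22,75); (23,36); (24,81); (25,67);
   (29,41); (30,76); (31,42); (32,79); (33,55); (35,68); (39,73); (43,64);
   (45,54); (46,86); (47,57); (48,52); (49,84); (51,69); (53,70); (56,72);
   (58,87); (59,62); (63,71); (66,85); (77,91); (88,90)]);
  (187, 11, 66, [:: (1,77); (2,55); (3,78); (4,84); (5,67); (6,40); (7,62);
   (8,36); (9,10); (12,73); (13,24); (14,53); (15,74); (16,54); (17,57);
   (18,65); (19,31); (20,51); (21,44); (22,32); (23,28); (25,52); (26,58);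
   (27,69); (29,85); (30,93); (33,35); (34,56); (37,45); (38,63); (39,88);
   (41,59); (42,66); (43,50); (46,49); (47,82); (48,91); (60,75); (61,81);
   (64,90); (68,89); (70,76); (71,80); (72,86); (79,92); (83,87)]);
  (191, 1, 57, [:: (2,68); (3,43); (4,35); (5,76); (6,11); (7,75); (8,20);
   (9,36); (10,40); (12,46); (13,23); (14,51); (15,26); (16,70); (17,86);
   (18,62); (19,78); (21,85); (22,73); (24,50); (25,48); (27,88); (28,91);
   (29,49); (30,77); (31,83); (32,61); (33,66); (34,53); (37,79); (38,41);
   (39,92); (42,58); (44,57); (45,63); (47,55); (52,90); (54,89); (56,80);
   (59,65); (60,69); (64,71); (67,81); (72,87); (74,95); (82,84); (93,94)]);
  (199, 1, 20, [:: (2,33); (3,43); (4,29); (5,76); (6,57); (7,93); (8,65);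
   (9,83); (10,13); (11,91); (12,40); (14,58); (15,73); (16,18); (17,36);
   (19,64); (20,90); (21,63); (22,71); (23,24); (25,30); (26,69); (27,81);
   (28,96); (31,72); (32,46); (34,99); (35,41); (37,45); (38,94); (39,75);
   (42,80); (44,68); (47,51); (48,87); (49,56); (50,59); (52,78); (53,85);
   (54,66); (55,84); (60,77); (61,79); (62,89); (67,82); (70,92); (74,95);
   (86,97); (88,98)]);
  (203, 29, 87, [:: (1,48); (2,30); (3,9); (4,87); (5,21); (6,13); (7,78);
   (8,72); (10,86); (11,50); (12,17); (14,100); (15,63); (16,83); (18,52);
   (19,46); (20,38); (22,79); (23,74); (24,84); (25,28); (26,64); (27,41);
   (31,97); (32,45); (33,70); (34,76); (35,80); (36,56); (37,92); (39,43);
   (40,94); (42,67); (44,96); (47,58); (49,82); (51,73); (53,77); (54,90);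
   (55,98); (57,65); (59,60); (61,101); (62,85); (66,75); (68,89); (69,99);
   (71,88); (81,91); (93,95)]);
  (219, 1, 32, [:: (2,56); (3,34); (4,104); (5,84); (6,80); (7,9); (8,96);
   (10,62); (11,36); (12,81); (13,108); (14,50); (15,90); (16,83); (17,51);
   (18,67); (19,22); (20,39); (21,27); (23,105); (24,57); (25,37); (26,31);
   (28,94); (29,72); (30,47); (32,46); (33,103); (35,77); (38,64); (40,95);
   (41,86); (42,71); (43,53); (44,66); (45,101); (48,55); (49,99); (52,73);
   (54,78); (58,85); (59,97); (60,69); (61,107); (63,76); (65,93); (68,91);
   (70,109); (74,92); (75,79); (82,102); (87,88); (89,100); (98,106)]);
  (219, 1, 41, [:: (2,66); (3,74); (4,6); (5,50); (7,87); (8,80); (9,65);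
   (10,91); (11,32); (12,47); (13,95); (14,56); (15,43); (16,70); (17,100);
   (18,49); (19,109); (20,28); (21,106); (22,97); (23,53); (24,60); (25,72);
   (26,35); (27,46); (29,69); (30,79); (31,48); (33,90); (34,59); (36,96);
   (37,41); (38,77); (39,73); (40,55); (42,108); (44,62); (45,58); (51,54);
   (52,78); (57,63); (61,107); (64,102); (67,89); (68,101); (71,83); (75,82);
   (76,99); (81,86); (84,98); (85,105); (88,104); (92,103); (93,94)]);
  (219, 73, 73, [:: (1,26); (2,7); (3,45); (4,30); (5,17); (6,55); (8,70);
   (9,84); (10,48); (11,107); (12,69); (13,46); (14,78); (15,98); (16,66);
   (18,103); (19,105); (20,57); (21,91); (22,25); (23,102); (24,41); (27,95);
   (28,81); (29,100); (31,74); (32,99); (33,51); (34,40); (35,54); (36,68);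
   (37,39); (38,79); (42,58); (43,44); (47,61); (49,101); (50,89); (52,76);
   (53,63); (56,64); (59,94); (60,96); (62,85); (65,109); (67,97); (71,92);
   (72,87); (75,104); (77,88); (80,108); (82,86); (83,90); (93,106)]);
  (223, 1, 15, [:: (2,50); (3,58); (4,73); (5,41); (6,82); (7,91); (8,97);
   (9,54); (10,83); (11,68); (12,80); (13,14); (15,105); (16,18); (17,98);
   (19,25); (20,33); (21,92); (22,78); (23,51); (24,42); (26,59); (27,64);
   (28,100); (29,49); (30,77); (31,71); (32,35); (34,109); (36,61); (37,69);
   (38,81); (39,48); (40,56); (43,94); (44,70); (45,95); (46,76); (47,111);
   (52,60); (53,88); (55,74); (57,67); (62,103); (63,101); (65,104); (66,87);
   (72,89); (75,99); (79,84); (85,96); (86,108); (90,102); (93,107);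
   (106,110)]);
  (231, 11, 33, [:: (1,31); (2,69); (3,107); (4,9); (5,81); (6,35); (7,62);
   (8,30); (10,29); (12,49); (13,90); (14,108); (15,96); (16,89); (17,65);
   (18,75); (19,66); (20,71); (21,33); (22,57); (23,85); (24,88); (25,53);
   (26,109); (27,61); (28,74); (32,36); (34,99); (37,95); (38,78); (39,105);
   (40,67); (41,51); (42,92); (43,87); (44,46); (45,68); (47,100); (48,111);
   (50,56); (52,104); (54,63); (55,76); (58,114); (59,83); (60,91); (64,72);
   (70,112); (73,84); (77,94); (79,82); (80,106); (86,102); (93,113); (97,98);
   (101,115); (103,110)]);
  (231, 33, 22, [:: (1,111); (2,109); (3,58); (4,37); (5,100); (6,9); (7,85);
   (8,74); (10,61); (11,90); (12,72); (13,51); (14,99); (15,28); (16,40);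
   (17,106); (18,70); (19,26); (20,34); (21,53); (22,41); (23,57); (24,110);
   (25,102); (27,66); (29,73); (30,46); (31,101); (32,59); (35,65); (36,86);
   (38,43); (39,64); (42,91); (44,112); (45,49); (47,78); (48,96); (50,67);
   (52,89); (54,62); (55,114); (56,79); (60,88); (63,103); (68,94); (69,104);
   (71,113); (75,84); (76,82); (77,97); (80,98); (81,83); (87,108); (92,93);
   (95,107); (105,115)]);
  (235, 5, 35, [:: (1,71); (2,19); (3,90); (4,94); (6,105); (7,116); (8,49);
   (9,45); (10,55); (11,36); (12,70); (13,109); (14,18); (15,79); (16,72);
   (17,88); (20,59); (21,112); (22,24); (23,26); (25,52); (27,113); (28,89);
   (29,91); (30,78); (31,73); (32,69); (33,47); (34,50); (35,48); (37,66);
   (38,81); (39,61); (40,74); (41,65); (42,43); (44,84); (46,114); (51,103);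
   (53,104); (54,92); (56,87); (57,68); (58,111); (60,115); (62,106); (63,75);
   (64,97); (67,95); (76,96); (77,82); (80,86); (83,93); (85,100); (98,107);
   (99,117); (101,108); (102,110)]);
  (239, 1, 99, [:: (2,20); (3,29); (4,57); (5,119); (6,49); (7,112); (8,60);
   (9,86); (10,39); (11,61); (12,99); (13,96); (14,103); (15,108); (16,24);
   (17,71); (18,82); (19,46); (21,115); (22,64); (23,83); (25,44); (26,33);
   (27,58); (28,48); (30,51); (31,32); (34,78); (35,102); (36,111); (37,95);
   (38,42); (40,56); (41,80); (43,105); (45,81); (47,88); (50,116); (52,97);
   (53,55); (54,87); (59,106); (62,67); (63,75); (65,90); (66,94); (68,74);
   (69,92); (70,118); (72,110); (73,84); (76,93); (77,91); (79,114); (85,98);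
   (89,113); (100,109); (101,104); (107,117)]);
  (243, 9, 9, [:: (1,52); (2,91); (3,101); (4,120); (5,66); (6,76); (7,95);
   (8,89); (10,37); (11,19); (12,24); (13,39); (14,46); (15,81); (16,116);
   (17,100); (18,62); (20,93); (21,80); (22,77); (23,71); (25,110); (26,94);
   (27,50); (28,48); (29,40); (30,44); (31,53); (32,33); (34,88); (35,99);
   (36,42); (38,113); (41,84); (43,64); (45,86); (47,82); (49,56); (51,97);
   (54,79); (55,60); (57,119); (58,98); (59,78); (61,92); (63,108); (65,75);
   (67,85); (68,96); (69,118); (70,87); (72,114); (73,107); (74,111); (83,121);
   (90,103); (102,117); (104,106); (105,109); (112,115)]);
  (243, 9, 18, [:: (1,40); (2,73); (3,86); (4,72); (5,65); (6,34); (7,49);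
   (8,110); (10,88); (11,35); (12,26); (13,19); (14,78); (15,92); (16,100);
   (17,121); (18,44); (20,47); (21,76); (22,51); (23,77); (24,75); (25,84);
   (27,93); (28,37); (29,74); (30,99); (31,111); (32,117); (33,63); (36,97);
   (38,55); (39,52); (41,94); (42,79); (43,87); (45,119); (46,82); (48,105);
   (50,61); (53,103); (54,70); (56,81); (57,104); (58,59); (60,95); (62,69);
   (64,107); (66,114); (67,90); (68,80); (71,91); (83,102); (85,106); (89,120);
   (96,98); (101,109); (108,113); (112,116); (115,118)]);
  (243, 9, 36, [:: (1,117); (2,23); (3,82); (4,33); (5,64); (6,116); (7,11);
   (8,83); (10,41); (12,58); (13,113); (14,70); (15,121); (16,24); (17,37);
   (18,91); (19,84); (20,94); (21,73); (22,65); (25,38); (26,87); (27,85);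
   (28,40); (29,57); (30,75); (31,120); (32,51); (34,68); (35,76); (36,46);
   (39,89); (42,108); (43,119); (44,60); (45,54); (47,95); (48,115); (49,98);
   (50,103); (52,67); (53,92); (55,93); (56,79); (59,61); (62,104); (63,118);
   (66,80); (69,102); (71,101); (72,107); (74,81); (77,88); (78,105); (86,110);
   (90,96); (97,114); (99,100); (106,111); (109,112)]);
  (243, 9, 45, [:: (1,28); (2,30); (3,14); (4,97); (5,99); (6,37); (7,63);
   (8,79); (10,26); (11,52); (12,27); (13,71); (15,96); (16,51); (17,74);
   (18,107); (19,111); (20,118); (21,87); (22,98); (23,49); (24,120); (25,72);
   (29,112); (31,38); (32,105); (33,82); (34,56); (35,47); (36,78); (39,92);
   (40,46); (41,75); (42,94); (43,57); (44,121); (45,95); (48,73); (50,60);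
   (53,66); (54,114); (55,103); (58,76); (59,89); (61,65); (62,102); (64,115);
   (67,88); (68,101); (69,113); (70,108); (77,86); (80,117); (81,100);
   (83,106); (84,104); (85,90); (91,93); (109,110); (116,119)]);
  (243, 9, 63, [:: (1,121); (2,23); (3,107); (4,77); (5,14); (6,68); (7,24);
   (8,47); (10,69); (11,105); (12,70); (13,54); (15,65); (16,118); (17,101);
   (18,94); (19,117); (20,31); (21,67); (22,79); (25,41); (26,44); (27,81);
   (28,63); (29,66); (30,57); (32,45); (33,73); (34,119); (35,36); (37,89);
   (38,102); (39,61); (40,46); (42,86); (43,108); (48,90); (49,83); (50,97);
   (51,99); (52,113); (53,76); (55,75); (56,112); (58,96); (59,85); (60,64);
   (62,98); (71,104); (72,74); (78,93); (80,110); (82,92); (84,116); (87,111);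
   (88,95); (91,103); (100,114); (106,109); (115,120)]);
  (243, 9, 72, [:: (1,50); (2,73); (3,35); (4,115); (5,40); (6,33); (7,101);
   (8,10); (11,12); (13,71); (14,66); (15,97); (16,47); (17,51); (18,107);
   (19,117); (20,81); (21,95); (22,28); (23,60); (24,45); (25,121); (26,118);
   (27,86); (29,77); (30,70); (31,119); (32,89); (34,56); (36,41); (37,92);
   (38,49); (39,63); (42,98); (43,85); (44,108); (46,116); (48,110); (52,65);
   (53,57); (54,69); (55,83); (58,112); (59,106); (61,78); (62,72); (64,84);
   (67,111); (68,109); (74,93); (75,82); (76,88); (79,104); (80,96); (87,113);
   (90,120); (91,99); (94,103); (100,114); (102,105)]);
  (243, 9, 90, [:: (1,32); (2,99); (3,112); (4,89); (5,76); (6,116); (7,93);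
   (8,69); (10,86); (11,73); (12,22); (13,17); (14,33); (15,74); (16,119);
   (18,47); (19,39); (20,84); (21,29); (23,114); (24,92); (25,27); (26,100);
   (28,45); (30,57); (31,49); (34,85); (35,60); (36,96); (37,81); (38,64);
   (40,43); (41,97); (42,65); (44,50); (46,53); (48,120); (51,79); (52,109);
   (54,66); (55,90); (56,95); (58,71); (59,105); (61,104); (62,111); (63,68);
   (67,107); (70,106); (72,117); (75,113); (77,78); (80,121); (82,98); (83,94);
   (87,108); (88,102); (91,115); (101,110); (103,118)]);
  (243, 9, 99, [:: (1,105); (2,62); (3,74); (4,26); (5,11); (6,41); (7,60);
   (8,23); (10,58); (12,115); (13,45); (14,59); (15,85); (16,79); (17,19);
   (18,44); (20,109); (21,97); (22,76); (24,81); (25,110); (27,88); (28,121);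
   (29,50); (30,111); (31,70); (32,98); (33,120); (34,35); (36,95); (37,87);
   (38,72); (39,113); (40,48); (42,80); (43,53); (46,51); (47,89); (49,68);
   (52,108); (54,57); (55,106); (56,67); (61,90); (63,100); (64,107); (65,69);
   (66,91); (71,94); (73,86); (75,93); (77,117); (78,119); (82,96); (83,116);
   (84,104); (92,99); (101,118); (102,114); (103,112)]);
  (243, 9, 117, [:: (1,94); (2,86); (3,17); (4,61); (5,87); (6,13); (7,52);
   (8,97); (10,22); (11,101); (12,84); (14,116); (15,100); (16,51); (18,34);
   (19,24); (20,78); (21,57); (23,32); (25,26); (27,35); (28,96); (29,75);
   (30,47); (31,91); (33,77); (36,63); (37,60); (38,102); (39,70); (40,89);
   (41,121); (42,66); (43,106); (44,120); (45,82); (46,72); (48,95); (49,88);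
   (50,119); (53,83); (54,69); (55,105); (56,112); (58,98); (59,113); (62,80);
   (64,93); (65,67); (68,109); (71,99); (73,79); (74,108); (76,114); (81,92);
   (85,110); (90,111); (103,107); (104,117); (115,118)]);
  (255, 5, 55, [:: (1,83); (2,35); (3,96); (4,13); (6,77); (7,29); (8,67);
   (9,98); (10,108); (11,21); (12,51); (14,60); (15,123); (16,76); (17,45);
   (18,22); (19,105); (20,121); (23,26); (24,71); (25,125); (27,94); (28,107);
   (30,38); (31,79); (32,97); (33,109); (34,78); (36,42); (37,93); (39,119);
   (40,47); (41,55); (43,101); (44,59); (46,100); (48,75); (49,102); (50,111);
   (52,63); (53,117); (54,74); (56,80); (57,82); (58,127); (61,113); (62,103);
   (64,69); (65,99); (66,87); (68,81); (70,112); (72,95); (73,116); (84,114);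
   (85,120); (86,124); (88,90); (89,115); (91,92); (104,122); (106,118);
   (110,126)]);
  (255, 5, 115, [:: (1,58); (2,24); (3,64); (4,12); (6,38); (7,121); (8,55);
   (9,77); (10,40); (11,122); (13,119); (14,21); (15,95); (16,113); (17,126);
   (18,73); (19,89); (20,85); (22,67); (23,115); (25,63); (26,78); (27,51);
   (28,32); (29,56); (30,125); (31,44); (33,109); (34,59); (35,101); (36,54);
   (37,83); (39,120); (41,43); (42,65); (45,116); (46,75); (47,84); (48,53);
   (49,107); (50,123); (52,105); (57,68); (60,79); (61,76); (62,90); (66,117);
   (69,103); (70,106); (71,110); (72,81); (74,94); (80,111); (82,124); (86,92);
   (87,127); (88,98); (91,108); (93,114); (96,97); (99,102); (100,112);
   (104,118)]);
  (255, 85, 85, [:: (1,3); (2,67); (4,50); (5,72); (6,88); (7,113); (8,52);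
   (9,32); (10,101); (11,48); (12,20); (13,75); (14,49); (15,87); (16,99);
   (17,106); (18,43); (19,59); (21,100); (22,73); (23,45); (24,69); (25,80);
   (26,96); (27,74); (28,56); (29,119); (30,94); (31,79); (33,125); (34,46);
   (35,111); (36,107); (37,90); (38,104); (39,42); (40,98); (41,127); (44,93);
   (47,83); (51,57); (53,63); (54,97); (55,64); (58,71); (60,81); (61,95);
   (62,118); (65,92); (66,116); (68,84); (70,89); (76,105); (77,78); (82,121);
   (86,112); (91,122); (102,120); (103,114); (108,123); (109,126); (110,115);
   (117,124)]);
  (259, 37, 111, [:: (1,128); (2,62); (3,58); (4,17); (5,95); (6,57); (7,63);
   (8,105); (9,31); (10,99); (11,83); (12,81); (13,78); (14,43); (15,97);
   (16,60); (18,85); (19,102); (20,116); (21,26); (22,24); (23,55); (25,124);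
   (27,89); (28,47); (29,113); (30,71); (32,36); (33,104); (34,92); (35,80);
   (38,90); (39,67); (40,79); (41,114); (42,53); (44,61); (45,126); (46,56);
   (48,72); (49,75); (50,68); (51,94); (52,82); (54,120); (59,108); (64,87);
   (65,115); (66,86); (69,103); (70,112); (73,100); (74,111); (76,129);
   (77,84); (88,91); (93,107); (96,127); (98,123); (101,110); (106,118);
   (109,117); (119,125); (121,122)]);
  (263, 1, 110, [:: (2,4); (3,64); (5,63); (6,118); (7,71); (8,42); (9,122);
   (10,131); (11,54); (12,115); (13,33); (14,129); (15,96); (16,70); (17,66);
   (18,37); (19,44); (20,79); (21,113); (22,123); (23,65); (24,95); (25,26);
   (27,106); (28,81); (29,60); (30,47); (31,45); (32,76); (34,57); (35,105);
   (36,120); (38,67); (39,51); (40,125); (41,59); (43,73); (46,121); (48,56);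
   (49,97); (50,119); (52,85); (53,75); (55,94); (58,103); (61,77); (62,128);
   (68,108); (69,101); (72,109); (74,83); (78,88); (80,127); (82,86); (84,99);
   (87,114); (89,100); (90,116); (91,112); (92,130); (93,98); (102,126);
   (104,107); (110,117); (111,124)]);
  (267, 1, 114, [:: (2,110); (3,8); (4,132); (5,48); (6,121); (7,14); (9,74);
   (10,20); (11,55); (12,90); (13,58); (15,66); (16,83); (17,78); (18,125);
   (19,123); (21,63); (22,84); (23,69); (24,98); (25,45); (26,54); (27,52);
   (28,122); (29,47); (30,67); (31,72); (32,130); (33,80); (34,38); (35,91);
   (36,111); (37,92); (39,93); (40,127); (41,50); (42,68); (43,103); (44,112);
   (46,77); (49,81); (51,128); (53,56); (57,114); (59,75); (60,89); (61,120);
   (62,86); (64,87); (65,101); (70,104); (71,106); (73,131); (76,109);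
   (79,119); (82,96); (85,97); (88,115); (94,100); (95,133); (99,118);
   (102,117); (105,113); (107,108); (116,129); (124,126)]);
  (267, 3, 14, [:: (1,43); (2,10); (4,30); (5,96); (6,132); (7,83); (8,63);
   (9,27); (11,89); (12,58); (13,53); (14,120); (15,71); (16,99); (17,110);
   (18,93); (19,101); (20,92); (21,88); (22,25); (23,39); (24,37); (26,106);
   (28,82); (29,52); (31,129); (32,121); (33,66); (34,91); (35,70); (36,41);
   (38,126); (40,125); (42,74); (44,128); (45,109); (46,73); (47,98); (48,49);
   (50,81); (51,79); (54,119); (55,94); (56,65); (57,131); (59,104); (60,84);
   (61,114); (62,77); (64,116); (67,127); (68,75); (69,90); (72,78); (76,95);
   (80,118); (85,133); (86,123); (87,112); (97,107); (100,117); (102,122);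
   (103,105); (108,130); (111,115); (113,124)]);
  (271, 1, 96, [:: (2,104); (3,46); (4,73); (5,20); (6,80); (7,64); (8,118);
   (9,129); (10,31); (11,13); (12,42); (14,17); (15,57); (16,24); (18,109);
   (19,75); (21,37); (22,45); (23,84); (25,123); (26,63); (27,132); (28,121);
   (29,124); (30,113); (32,102); (33,114); (34,48); (35,62); (36,40); (38,66);
   (39,119); (41,101); (43,127); (44,95); (47,94); (49,97); (50,112); (51,106);
   (52,88); (53,82); (54,100); (55,108); (56,65); (58,110); (59,60); (61,125);
   (67,89); (68,103); (69,86); (70,90); (71,134); (72,131); (74,107); (76,120);
   (77,116); (78,128); (79,105); (81,91); (83,115); (85,98); (87,92); (93,99);
   (96,130); (111,122); (117,135); (126,133)]);
  (275, 55, 55, [:: (1,18); (2,63); (3,90); (4,38); (5,100); (6,50); (7,64);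
   (8,116); (9,128); (10,39); (11,17); (12,62); (13,107); (14,77); (15,117);
   (16,95); (19,70); (20,23); (21,47); (22,120); (24,60); (25,48); (26,101);
   (27,32); (28,131); (29,61); (30,106); (31,119); (33,85); (34,92); (35,127);
   (36,49); (37,123); (40,112); (41,105); (42,58); (43,126); (44,124); (45,83);
   (46,99); (51,53); (52,79); (54,87); (56,137); (57,96); (59,104); (65,113);
   (66,74); (67,91); (68,86); (69,136); (71,108); (72,93); (73,133); (75,122);
   (76,98); (78,88); (80,81); (82,94); (84,125); (89,109); (97,132); (102,111);
   (103,118); (110,135); (114,121); (115,129); (130,134)]);
  (275, 55, 110, [:: (1,104); (2,43); (3,74); (4,103); (5,67); (6,34); (7,19);
   (8,114); (9,23); (10,107); (11,77); (12,66); (13,52); (14,134); (15,126);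
   (16,110); (17,47); (18,49); (20,132); (21,122); (22,124); (24,46); (25,48);
   (26,42); (27,32); (28,119); (29,125); (30,39); (31,87); (33,60); (35,115);
   (36,83); (37,72); (38,76); (40,44); (41,96); (45,106); (50,133); (51,111);
   (53,82); (54,88); (56,59); (57,120); (58,101); (61,78); (62,68); (63,81);
   (64,116); (65,102); (69,127); (70,123); (71,128); (73,117); (75,100);
   (79,121); (80,91); (84,105); (85,109); (86,99); (89,135); (90,98); (92,94);
   (93,108); (95,131); (97,130); (112,113); (118,137); (129,136)]);
  (287, 1, 17, [:: (2,91); (3,55); (4,88); (5,100); (6,104); (7,94); (8,59);
   (9,45); (10,140); (11,101); (12,23); (13,98); (14,142); (15,22); (16,26);
   (17,124); (18,57); (19,136); (20,133); (21,118); (24,36); (25,41); (27,115);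
   (28,53); (29,125); (30,49); (31,113); (32,72); (33,102); (34,82); (35,48);
   (37,40); (38,111); (39,119); (42,44); (43,77); (46,120); (47,75); (50,56);
   (51,122); (52,67); (54,130); (58,78); (60,65); (61,79); (62,126); (63,106);
   (64,96); (66,112); (68,95); (69,92); (70,123); (71,116); (73,99); (74,135);
   (76,109); (80,84); (81,138); (83,139); (85,132); (86,110); (87,128);
   (89,90); (93,131); (97,141); (103,134); (105,127); (107,121); (108,117);
   (114,143); (129,137)]);
  (287, 1, 24, [:: (2,48); (3,17); (4,137); (5,87); (6,70); (7,98); (8,92);
   (9,133); (10,113); (11,56); (12,83); (13,102); (14,25); (15,125); (16,128);
   (18,108); (19,23); (20,43); (21,86); (22,40); (24,107); (26,52); (27,46);
   (28,129); (29,58); (30,105); (31,140); (32,93); (33,66); (34,136); (35,132);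
   (36,77); (37,85); (38,50); (39,54); (41,73); (42,94); (44,74); (45,114);
   (47,91); (49,104); (51,53); (55,72); (57,134); (59,80); (60,116); (61,68);
   (62,119); (63,69); (64,115); (65,103); (67,141); (71,79); (75,118);
   (76,130); (78,88); (81,121); (82,135); (84,131); (89,138); (90,99);
   (95,126); (96,123); (97,110); (100,101); (106,122); (109,143); (111,139);
   (112,117); (120,142); (124,127)]);
  (287, 7, 119, [:: (1,142); (2,49); (3,139); (4,86); (5,134); (6,72); (8,76);
   (9,106); (10,113); (11,13); (12,60); (14,114); (15,78); (16,73); (17,57);
   (18,21); (19,143); (20,55); (22,40); (23,68); (24,28); (25,36); (26,81);
   (27,122); (29,89); (30,135); (31,56); (32,82); (33,75); (34,120); (35,99);
   (37,44); (38,132); (39,116); (41,61); (42,88); (43,131); (45,54); (46,63);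
   (47,69); (48,127); (50,71); (51,84); (52,125); (53,87); (58,123); (59,102);
   (62,98); (64,92); (65,118); (66,110); (67,83); (70,119); (74,93); (77,109);
   (79,138); (80,111); (85,126); (90,117); (91,129); (94,108); (95,100);
   (96,133); (97,107); (101,130); (103,115); (104,112); (105,128); (121,136);
   (124,137); (140,141)]);
  (287, 41, 123, [:: (1,106); (2,19); (3,97); (4,122); (5,96); (6,92);
   (7,128); (8,88); (9,70); (10,18); (11,27); (12,17); (13,91); (14,69);
   (15,57); (16,74); (20,67); (21,120); (22,141); (23,36); (24,50); (25,45);
   (26,103); (28,61); (29,35); (30,101); (31,81); (32,100); (33,126); (34,140);
   (37,80); (38,105); (39,83); (40,102); (42,130); (43,124); (44,129); (46,64);
   (47,131); (48,49); (51,87); (52,98); (53,104); (54,117); (55,78); (56,71);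
   (58,93); (59,66); (60,125); (62,72); (63,85); (65,114); (68,79); (73,139);
   (75,109); (76,116); (77,134); (82,123); (84,111); (86,90); (89,142);
   (94,133); (95,119); (99,136); (107,132); (108,110); (112,121); (113,143);
   (115,127); (118,137); (135,138)]);
  (291, 1, 14, [:: (2,127); (3,5); (4,31); (6,134); (7,96); (8,129); (9,139);
   (10,42); (11,17); (12,145); (13,87); (14,19); (15,54); (16,38); (18,124);
   (20,77); (21,61); (22,109); (23,43); (24,39); (25,55); (26,64); (27,108);
   (28,95); (29,75); (30,78); (32,79); (33,112); (34,119); (35,60); (36,141);
   (37,82); (40,131); (41,53); (44,137); (45,120); (46,118); (47,65); (48,126);
   (49,52); (50,100); (51,116); (56,99); (57,58); (59,85); (62,130); (63,121);
   (66,107); (67,111); (68,84); (69,90); (70,123); (71,132); (72,136);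
   (73,122); (74,144); (76,138); (80,140); (81,88); (83,92); (86,103); (89,93);
   (91,114); (94,105); (97,110); (98,117); (101,135); (102,133); (104,128);
   (106,143); (113,142); (115,125)]);
  (291, 1, 83, [:: (2,107); (3,85); (4,12); (5,65); (6,93); (7,125); (8,28);
   (9,26); (10,61); (11,33); (13,88); (14,100); (15,142); (16,30); (17,79);
   (18,75); (19,122); (20,124); (21,55); (22,43); (23,115); (24,132); (25,114);
   (27,51); (29,108); (31,86); (32,116); (34,63); (35,135); (36,59); (37,91);
   (38,68); (39,76); (40,106); (41,82); (42,123); (44,89); (45,95); (46,84);
   (47,66); (48,74); (49,140); (50,57); (52,120); (53,127); (54,117); (56,104);
   (58,67); (60,102); (62,139); (64,111); (69,128); (70,72); (71,96); (73,145);
   (77,78); (80,144); (81,130); (83,98); (87,92); (90,103); (94,112); (97,136);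
   (99,131); (101,134); (105,133); (109,113); (110,141); (118,121); (119,129);
   (126,138); (137,143)]);
  (291, 97, 97, [:: (1,85); (2,111); (3,6); (4,27); (5,100); (7,56); (8,116);
   (9,23); (10,129); (11,139); (12,128); (13,79); (14,141); (15,92); (16,52);
   (17,57); (18,33); (19,106); (20,41); (21,54); (22,84); (24,80); (25,137);
   (26,119); (28,110); (29,93); (30,64); (31,72); (32,58); (34,62); (35,65);
   (36,81); (37,120); (38,77); (39,91); (40,59); (42,95); (43,48); (44,87);
   (45,114); (46,122); (47,102); (49,99); (50,60); (51,75); (53,118); (55,134);
   (61,83); (63,107); (66,124); (67,113); (68,105); (69,142); (70,86);
   (71,131); (73,140); (74,145); (76,82); (78,125); (88,89); (90,103);
   (94,112); (96,138); (98,123); (101,109); (104,133); (108,135); (115,117);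
   (121,132); (126,130); (127,144); (136,143)]);
  (299, 13, 65, [:: (1,10); (2,42); (3,128); (4,71); (5,89); (6,77); (7,126);
   (8,51); (9,19); (11,103); (12,99); (14,102); (15,133); (16,66); (17,120);
   (18,90); (20,28); (21,142); (22,67); (23,122); (24,53); (25,88); (26,104);
   (27,113); (29,64); (30,49); (31,111); (32,106); (33,101); (34,35); (36,137);
   (37,83); (38,138); (39,78); (40,149); (41,94); (43,59); (44,68); (45,62);
   (46,100); (47,108); (48,110); (50,55); (52,143); (54,96); (56,114); (57,75);
   (58,81); (60,124); (61,63); (65,91); (69,145); (70,82); (72,132); (73,129);
   (74,144); (76,127); (79,93); (80,121); (84,87); (85,92); (86,107); (95,131);
   (97,112); (98,135); (105,139); (109,141); (115,146); (116,136); (117,130);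
   (118,148); (119,123); (125,147); (134,140)])]%num.

(** * The exhaustive check that the certificates meet every orbit *)

Definition rhs (v : N) : N :=
  if N.eqb (N.modulo v 12) 3 then N.div v 3 else 0%num.

(* [if] rather than [&&], which [vm_compute] would evaluate on both sides *)
Definition reaches (v d n : N) (c : certificate) : bool :=
  let: (v', d', b, _) := c in
  if N.eqb v' v then
    if N.eqb d' d then
      has (fun j : nat =>
        let u := (1 + bin_of_nat j * N.div v d)%num in
        let ub := N.modulo (u * b) v in
        if N.eqb ub n || N.eqb ub (v - n) then coprime v u else false)
        (iota 0 d)
    else false
  else false.

(** For alpha = d, each solution [n] of the quadratic equation, taken up to sign, must be reached
    from some certificate by a unit that fixes [d]. The equation is written with [rhs v] added on
    the right to avoid subtraction in [N]. *)
Definition divisor_ok (v d : N) : bool :=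
  if N.eqb (N.modulo v d) 0 then
    all (fun n =>
      if N.eqb (N.modulo (2 * (d * d)) v) (N.modulo (n * n + rhs v) v)
      then has (reaches v d n) certificates else true) (nums (N.div2 v))
  else true.

Definition order_ok (k : nat) : bool :=
  let v := bin_of_nat (3 + 4 * k) in all (divisor_ok v) (nums (N.pred v)).

Lemma certificates_ok : all certificate_ok certificates.
Proof. by vm_compute. Qed.

(** The orders are 3, 7, ..., 299. One for which the equation has no solution passes vacuously. *)
Lemma orders_ok : all order_ok (iota 0 75).
Proof. by vm_compute. Qed.

Lemma Zres_rhs v : Zres v (rhs v) =
  if (v == 3 %[mod 12])%N then (v %/ 3)%:R else 0.
Proof.
rewrite /rhs; have -> : N.eqb (N.modulo v 12) 3 = (v == 3 %[mod 12])%N.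
  by have := @nat_of_bin_mod 12 v isT; lia.
case: ifP => // _; rewrite /Zres; congr _%:R.
have := N.div_mod v 3; have := N.mod_lt v 3.
set q := N.div _ _; set r := N.modulo _ _; lia.
Qed.

(** A sign may be lost twice, in passing from [b] to its lower-half representative [n] and in
    matching [n] with a multiple of the certificate's entry; [APS_list_oppr] restores it both
    times. *)
Lemma APS_list_divisor (v d : N) (b : 'Z_v) :
  (v = 3 %[mod 4])%N -> (v < 300)%N -> (0 < d < v)%N -> (d %| v)%N -> b != 0 ->
  2 * Zres v d ^+ 2 - b ^+ 2 = Zres v (rhs v) ->
  exists l, APS_list (Zres v d) b l.
Proof.
move=> v3 v300 d_lt d_v b_neq0 eqn; have v_gt1 : (1 < v)%N by lia.
have [n nN bE] := Zp_sign_half v_gt1 b_neq0.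
have bE2 : b ^+ 2 = Zres v n ^+ 2 by case: bE => ->; rewrite ?sqrrN.
have [d_gt0 _] := andP d_lt.
have dv0 : N.modulo v d = 0%num.
  by have := nat_of_bin_mod v d_gt0; move: d_v; rewrite /dvdn => /eqP ->; lia.
have /allP/(_ ((v - 3) %/ 4)%N) : all order_ok (iota 0 75) := orders_ok.
rewrite mem_iota => /(_ ltac:(lia)); rewrite /order_ok.
have -> : bin_of_nat (3 + 4 * ((v - 3) %/ 4)) = v by lia.
move=> /allP/(_ d); rewrite mem_nums => /(_ ltac:(lia)).
rewrite /divisor_ok dv0 => /allP/(_ n nN).
have -> : N.eqb (N.modulo (2 * (d * d)) v) (N.modulo (n * n + rhs v) v).
  rewrite -eq_Zres // ZresD !ZresM -eqn bE2; apply/eqP.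
  have -> : Zres v 2 = 2 by [].
  by ring.
case/hasP => -[[[v' d'] b'] l] /(allP certificates_ok) cok; rewrite /reaches.
case: N.eqb_spec => // Ev; case: N.eqb_spec => // Ed; subst v' d'.
case/hasP => j _; set u := (1 + _)%num.
(* Since (v / d) d = v, the factors 1 + j (v / d) are the residues that fix [d]: they move [b'] and
   leave alpha in place. *)
have ud : Zres v u * Zres v d = Zres v d.
  have := N.div_mod v d; rewrite dv0 => vE.
  rewrite -ZresM.
  have -> : (u * d = d + bin_of_nat j * v)%num by rewrite /u; nia.
  by rewrite ZresD ZresM Zres_v // mulr0 addr0.
have := nN; rewrite mem_nums => n_half.
(* [n] and [v - n] must be reduced for their comparison with a value of [N.modulo] to mean equality
   in ['Z_v]. *)
have n_v : (n < v)%N.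
  have := N.div2_odd v; move: (N.div2 v) n_half => h.
  by case: (N.odd v); rewrite /N.b2n; lia.
case: ifP => // ub uv.
have Uu : Zres v u \is a GRing.unit by rewrite unitZpE.
have {}ub : Zres v u * Zres v b' = Zres v n \/
            Zres v u * Zres v b' = - Zres v n.
  rewrite -ZresM; have [ub'|ub'] := orP ub; [left|right].
    apply/eqP; rewrite eq_Zres // (N.mod_small n) //; lia.
  rewrite -[- _]add0r -(Zres_v v_gt1) -ZresB; last by lia.
  apply/eqP; rewrite eq_Zres // (N.mod_small (v - n)) //; lia.
have := APS_list_mul Uu (certificate_APS cok); rewrite ud => lP.
suff [l' l'P] : exists l', APS_list (Zres v d) (Zres v n) l'.
  by exists l'; case: bE => ->; [|apply: APS_list_oppr].
case: ub lP => -> lP; first by eexists; exact: lP.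
by eexists; rewrite -[Zres v n]opprK; exact: APS_list_oppr lP.
Qed.

(** As 3 divides [v], [u] is prime to 3 and its square is 1 + 3 q; the surplus 3 q (v / 3) = v q
    vanishes. Thus the right-hand side of the quadratic equation survives the scaling of alpha and
    beta by a unit. *)
Lemma mulr_third_unit_sqr v (u : nat) : (v == 3 %[mod 12])%N -> coprime v u ->
  u%:R ^+ 2 * (v %/ 3)%:R = (v %/ 3)%:R :> 'Z_v.
Proof.
move=> v12 uv; have v_gt1 : (1 < v)%N by lia.
have u3 : ~~ (3 %| u)%N.
  by rewrite -prime_coprime // (coprime_dvdl (_ : 3 %| v)%N uv) //; lia.
have [q uE] : exists q, (u ^ 2 = 1 + 3 * q)%N.
  have [r [->|->]] : exists r, u = (3 * r + 1)%N \/ u = (3 * r + 2)%N.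
    by exists (u %/ 3)%N; lia.
    by exists (3 * r ^ 2 + 2 * r)%N; ring.
  by exists (3 * r ^ 2 + 4 * r + 1)%N; ring.
rewrite -natrX -natrM uE.
have -> : ((1 + 3 * q) * (v %/ 3) = v %/ 3 + v * q)%N.
  have : v = (v %/ 3 * 3)%N by lia.
  by move: (v %/ 3)%N => w ->; ring.
by rewrite natrD natrM pchar_Zp // mul0r addr0.
Qed.

Theorem theorem5p6 (v : nat) (v3mod4 : (v = 3 %[mod 4])%N) (v_lt300 : (v < 300)%N)
    (alpha beta : 'Z_v) (alpha_neq0 : alpha != 0) (beta_neq0 : beta != 0) :
  (exists S : {set {set 'Z_v}}, is_APS alpha beta S) <->
  2 * alpha ^+ 2 - beta ^+ 2 =
    (if (v == 3 %[mod 12])%N then (v %/ 3)%:R else 0).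
Proof.
have v_gt1 : (1 < v)%N by lia.
have card_v : #|{: 'Z_v}| = v by rewrite card_ord Zp_cast.
have U2 : (2 : 'Z_v) \is a GRing.unit by rewrite unitZpE // coprimen2; lia.
rewrite is_APS_list ?card_v //; split=> [[l /APS_list_sum_sqr]|eqn].
  (* Both expressions of the sum of squares carry the factor 2, a unit because [v] is odd. *)
  by rewrite sum_sqr_Zp // => /(mulrI U2) <-.
have [d /andP[d_lt dv] [u uv alphaE]] := Zp_associate_divisor v_gt1 alpha_neq0.
have Uu : (u%:R : 'Z_v) \is a GRing.unit by rewrite unitZpE.
pose b := u%:R^-1 * beta; have betaE : beta = u%:R * b by rewrite mulVKr.
suff [l lP] : exists l, APS_list (d%:R : 'Z_v) b l.
  exists [seq (u%:R * p.1, u%:R * p.2) | p <- l].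
  by rewrite alphaE betaE; apply: APS_list_mul.
have b_neq0 : b != 0.
  by apply: contraNneq beta_neq0 => b0; rewrite betaE b0 mulr0.
have {}eqn : 2 * d%:R ^+ 2 - b ^+ 2 =
    (if (v == 3 %[mod 12])%N then (v %/ 3)%:R else 0) :> 'Z_v.
  (* Multiplied by the square of the unit, the left-hand side becomes that for [alpha] and [beta],
     while the right-hand side does not change. *)
  apply: (mulrI (unitrX 2 Uu)); transitivity (2 * alpha ^+ 2 - beta ^+ 2).
    by rewrite alphaE betaE; ring.
  by rewrite eqn; case: ifP => v12; rewrite ?mulr0 // mulr_third_unit_sqr.
(* The check speaks of binary [v] and [d]. The type of [b] depends on [v], so [b] and its hypotheses
   are generalised before the numbers are replaced. *)
move: b b_neq0 eqn {betaE}.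
move: v3mod4 v_lt300 d_lt dv; rewrite -[v]bin_of_natK -[d]bin_of_natK.
move=> v3 v300 d_lt dv b b_neq0 eqn.
by apply: APS_list_divisor => //; rewrite Zres_rhs.
Qed.
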